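(* Suppose Assumptions 1-4 listed in the context hold. Let $(x_t),(\lambda_t)$ be generated by Algorithm 2 (described in the context) with $\alpha=\sqrt{\frac{T}{\tau+1}}$ and $\sigma=\sqrt{\frac{\tau+1}{T}}$. Let $x^*$ be an optimal solution of $\min_{x\in\mathcal C}\sum_{t=0}^{T-1}f_t(x)$ subject to $g_t(x)\le 0$ for all $t\in[T]$. Then $$\sum_{t=0}^{T-1}[f_t(x_t)-f_t(x^* )]\le\frac{\kappa_f^2+\nu_g^2+D^2}{2}\sqrt{(\tau+1)T}.$$
   Context: Setting. $\mathcal X$ is a finite-dimensional real Hilbert space with inner product $\langle\cdot,\cdot\rangle$ and induced norm $\|\cdot\|$; $\mathcal C\subseteq\mathcal X$ is a closed convex set. $T\ge1$, $p\ge 1$ and $\tau\ge0$ (the feedback delay) are integers with $T>\tau$, and $[T]=\{0,1,\ldots,T-1\}$. For each $t\in[T]$ there are a loss function $f_t:\mathcal C\to\mathbb R$ and a constraint function $g_t=(g_t^{(1)},\ldots,g_t^{(p)}):\mathcal C\to\mathbb R^p$. On $\mathbb R^p$, $\|\cdot\|$ is the Euclidean norm, inequalities between vectors are componentwise, and $[a]_+=\max\{a,0\}$ is applied componentwise. $\partial h(x)$ denotes the subdifferential (set of subgradients) of a convex function $h$ at $x$. Models. For each $t\in[T]$ and each reference point $x\in\mathcal C$ there are given convex functions $F_{t,x}$ and $G^{(i)}_{t,x}$, $i=1,\ldots,p$, real-valued on $\mathcal C$ (models of $f_t$ and $g_t^{(i)}$ at $x$); write $G_{t,x}=(G^{(1)}_{t,x},\ldots,G^{(p)}_{t,x})$.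 Assumption 1: the set $\mathcal C$ is bounded; there is a constant $D>0$ with $\|x-y\|\le D$ for all $x,y\in\mathcal C$. Assumption 2: every $f_t$ and $g_t^{(i)}$ is continuous and convex with bounded subgradients: there are constants $\kappa_f,\kappa_g>0$ (independent of $t,i$) such that $\|u_t\|\le\kappa_f$ and $\|v_t^{(i)}\|\le\kappa_g$ for all $x\in\mathcal C$, $u_t\in\partial f_t(x)$, $v_t^{(i)}\in\partial g_t^{(i)}(x)$. Assumption 3 (Slater): there are a constant $\varepsilon_0>0$ and $\widehat x\in\mathcal C$ (independent of $t$) with $g_t^{(i)}(\widehat x)\le-\varepsilon_0$ for $i=1,\ldots,p$ and all $t\in[T]$. Assumption 4: for all $t\in[T]$ and $x\in\mathcal C$: (i) $F_{t,x}(y)\le f_t(y)$ for all $y\in\mathcal C$, and $F_{t,x}(x)=f_t(x)$; (ii) for each $i=1,\ldots,p$, $G^{(i)}_{t,x}(y)\le g_t^{(i)}(y)$ for all $y\in\mathcal C$, and $G^{(i)}_{t,x}(x)=g_t^{(i)}(x)$; (iii) there is a constant $\nu_g>0$ (independent of $t,x$) with $\|G_{t,x}(y)\|\le\nu_g$ for all $y\in\mathcal C$. Algorithm 2 (model-based augmented Lagrangian method with delay $\tau$, parameters $\sigma,\alpha>0$). Choose any $x_0\in\mathcal C$, set $x_1=\cdots=x_\tau=x_0$ and $\lambda_0=\lambda_1=\cdots=\lambda_\tau=0\in\mathbb R^p$. With $$\mathcal L_{t,\sigma}(x,\lambda)=F_{t,x_t}(x)+\frac1{2\sigma}\left[\|[\lambda+\sigma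 G_{t,x_t}(x)]_+\|^2-\|\lambda\|^2\right],$$ for $t=\tau,\tau+1,\ldots,\tau+T-1$ set $$x_{t+1}=\operatorname{argmin}_{x\in\mathcal C}\left\{\mathcal L_{t-\tau,\sigma}(x,\lambda_t)+\frac{\alpha}{2}\|x-x_{t-\tau}\|^2\right\},\qquad \lambda_{t+1}=[\lambda_t+\sigma G_{t-\tau,x_{t-\tau}}(x_{t+1})]_+.$$
   Formalization: With losses and subgradients on C only, Assumptions 1-2 conflict (dim X>0); with subgradients on a larger set and models below f_t on C only, the bound fails. Here f_t, g_t and models live on a convex O⊇C (O=C or open), with convexity, continuity, subgradients and minorization all on O. *)

(* Defs.v *)
From HB Require Import structures.
From mathcomp Require Import all_boot all_order all_algebra.
From mathcomp Require Import sesquilinear.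
From mathcomp Require Import all_classical all_reals all_analysis.
Import Order.TTheory GRing.Theory Num.Theory.
Import numFieldNormedType.Exports.

Set Implicit Arguments.
Unset Strict Implicit.
Unset Printing Implicit Defensive.

Local Open Scope classical_set_scope.
Local Open Scope ring_scope.

#[short(type="finNormedModType")]
HB.structure Definition FinNormedModule (R : realType) :=
  {V of NormedModule R V & Vector R V}.

Definition norm_of_dot (R : realType) (X : finNormedModType R)
    (dot : {dot X for idfun}) : Prop :=
  forall x : X, `|x| = Num.sqrt (dot x x).

(* The library norm on row vectors is the sup norm. *)
Definition enorm (R : realType) (p : nat) (v : 'rV[R]_p) : R :=
  Num.sqrt (\sum_(i < p) v 0 i ^+ 2).

Definition pos_part (R : realType) (p : nat) (v : 'rV[R]_p) : 'rV[R]_p :=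
  \row_(i < p) Num.max (v 0 i) 0.

Definition is_argmin (R : realType) (X : Type) (A : set X) (phi : X -> R)
    (z : X) : Prop :=
  A z /\ forall y, A y -> phi z <= phi y.

(* A function defined only on a set O is represented by a total function whose
   values outside O are never used. *)
Definition subdifferential (R : realType) (X : finNormedModType R)
    (dot : {dot X for idfun}) (O : set X) (h : X -> R) (x : X) : set X :=
  [set u | forall y, O y -> h x + dot u (y - x) <= h y].

(* [O] is the common domain of the losses, the constraints and their models.
   Taking [O = C] gives functions that are known on [C] only. Subgradients
   relative to [C] are then stable under adding normal vectors of [C], so a
   uniform bound on them, with [C] bounded, forces the space to be trivial.
   Taking [O] open (for instance the whole space) gives the case in which a
   bound on the subgradients at the points of [C] is a Lipschitz condition. In
   that case the models have to be minorants on [O] for their subgradients at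
   the reference point to be subgradients of the modelled function. *)
Definition admissible_domain (R : realType) (X : finNormedModType R)
    (C O : set X) : Prop :=
  [/\ C `<=` O, convex_set O & O = C \/ open O].

Definition bounded_subgradients (R : realType) (X : finNormedModType R)
    (dot : {dot X for idfun}) (C O : set X) (kappa : R) (h : X -> R) : Prop :=
  forall x u, C x -> subdifferential dot O h x u -> `|u| <= kappa.

Definition is_model (R : realType) (X : finNormedModType R)
    (O : set X) (h : X -> R) (x : X) (m : X -> R) : Prop :=
  [/\ convex_function O m, forall y, O y -> m y <= h y & m x = h x].

Definition aug_lagrangian (R : realType) (X : finNormedModType R) (p : nat)
    (sigma : R) (F : X -> R) (G : X -> 'rV[R]_p) (x : X) (lambda : 'rV[R]_p)
    : R :=
  F x + (2 * sigma)^-1 *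
    (enorm (pos_part (lambda + sigma *: G x)) ^+ 2 - enorm lambda ^+ 2).

Definition delayed_model_alm (R : realType) (X : finNormedModType R) (p : nat)
    (C : set X) (T tau : nat) (F : nat -> X -> X -> R)
    (G : nat -> X -> X -> 'rV[R]_p) (sigma alpha : R)
    (x : nat -> X) (lambda : nat -> 'rV[R]_p) : Prop :=
  [/\ C (x 0%N),
      forall t, (t <= tau)%N -> x t = x 0%N /\ lambda t = 0 &
      forall t, (tau <= t < tau + T)%N ->
        let s := (t - tau)%N in
        is_argmin C
          (fun z => aug_lagrangian sigma (F s (x s)) (G s (x s)) z (lambda t)
                    + alpha / 2 * `|z - x s| ^+ 2)
          (x t.+1) /\
        lambda t.+1 = pos_part (lambda t + sigma *: G s (x s) (x t.+1))].

Definition feasible_set (R : realType) (X : finNormedModType R) (p : nat)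
    (C : set X) (T : nat) (g : nat -> X -> 'rV[R]_p) : set X :=
  [set z | C z /\ forall t, (t < T)%N -> forall i, g t z 0 i <= 0].

(* Main.v *)
(* With s = t - tau, strong convexity of the proximal subproblem gives a
   three-point inequality at x_{t+1} against the optimum z. The multiplier term
   at z is nonpositive by feasibility, and F_{s,x_s}(x_{t+1}) is bounded below
   through a subgradient of the model at x_s, which is also a subgradient of
   f_s. Hence f_s(x_s) - f_s(z) is at most kappa_f^2 / (2 alpha) plus the
   decrease of |lambda|^2 / (2 sigma) plus
   (alpha / 2) (|z - x_s|^2 - |z - x_{s+tau+1}|^2);
   summing over s, the last differences leave at most tau + 1 terms.

   The subgradient exists when the common domain O is open. When O = C, the
   bound on the subgradients relative to the bounded set C forces the space to
   be trivial. *)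
Require Import Defs.
From HB Require Import structures.
From mathcomp Require Import all_boot all_order all_algebra.
From mathcomp Require Import sesquilinear ring lra.
From mathcomp Require Import all_classical all_reals all_analysis.
Import Order.TTheory GRing.Theory Num.Theory.
Import numFieldNormedType.Exports.

Local Open Scope classical_set_scope.
Local Open Scope ring_scope.

Set Implicit Arguments.
Unset Strict Implicit.
Unset Printing Implicit Defensive.

(** * Inner product identities and coordinates in a dual basis *)

Lemma dotC (R : realType) (X : lmodType R) (dot : {dot X for idfun}) x y :
  dot x y = dot y x.
Proof. by rewrite hermC /= expr0 mul1r. Qed.

Lemma dot_eq0 (R : realType) (X : lmodType R) (dot : {dot X for idfun}) x :
  dot x x = 0 -> x = 0.
Proof.
move=> xx; apply/eqP/negPn/negP => /(neq0_dnorm_gt0 (s := dot)).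
by rewrite xx ltxx.
Qed.

Lemma dotxx (R : realType) (X : finNormedModType R)
    (dot : {dot X for idfun}) (hdot : norm_of_dot dot) x :
  dot x x = `|x| ^+ 2.
Proof.
rewrite hdot sqr_sqrtr//; have [->|x0] := eqVneq x 0; first by rewrite linear0l.
exact/ltW/neq0_dnorm_gt0.
Qed.

Lemma sqr_norm_add (R : realType) (X : finNormedModType R)
    (dot : {dot X for idfun}) (hdot : norm_of_dot dot) x y :
  `|x + y| ^+ 2 = `|x| ^+ 2 + 2 * dot x y + `|y| ^+ 2.
Proof.
rewrite -!(dotxx hdot) linearDl !linearDr /= (dotC dot y x); ring.
Qed.

(* The Gram map x |-> (dot x (e j))_j is injective, and b is the image of the
   canonical basis under a left inverse of it. *)
Lemma dual_basis (R : realType) (X : finNormedModType R)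
    (dot : {dot X for idfun}) :
  exists n (e b : 'I_n -> X), forall x, x = \sum_j dot x (e j) *: b j.
Proof.
pose e (j : 'I_(\dim (fullv : {vspace X}))) := (vbasis fullv : seq X)`_j.
pose gram x : 'rV[R]_(\dim (fullv : {vspace X})) := \row_j dot x (e j).
have gram_linear : linear gram.
  by move=> a x y; apply/rowP => j; rewrite !mxE linearDl linearZl_LR.
pose gramL := GRing.isLinear.Build _ _ _ _ gram gram_linear.
pose gl : {linear X -> 'rV[R]_(\dim (fullv : {vspace X}))} :=
  HB.pack gram gramL.
have ker0 : lker (linfun gl) == 0%VS.
  apply/lker0P => x y; rewrite !lfunE /= => exy.
  apply: subr0_eq; apply: (dot_eq0 (dot := dot)).
  rewrite {2}(coord_vbasis (memvf (x - y))) linear_sumr big1// => j _.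
  have /rowP/(_ j) := exy; rewrite !mxE => exyj.
  rewrite linearZr_LR linearBl; apply: etrans (mulr0 _); congr (_ * _).
  by apply/eqP; rewrite subr_eq0; apply/eqP.
exists _, e, (fun j => (linfun gl)^-1%VF (delta_mx 0 j)) => x.
rewrite -[LHS](lker0_lfunK ker0) lfunE /= [gram x]row_sum_delta linear_sum.
by apply: eq_bigr => j _; rewrite linearZ mxE.
Qed.

(** * Sublinear functions and their linear minorants *)

(** Homogeneity is asked only as an inequality, which is easier to check for infima; applying it to
    [c^-1] as well gives equality. *)
Definition sublinear (R : realType) (V : lmodType R) (h : V -> R) : Prop :=
  (forall x y, h (x + y) <= h x + h y) /\
  (forall c x, 0 < c -> h (c *: x) <= c * h x).

Lemma sublinearZ (R : realType) (V : lmodType R) (h : V -> R) :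
  sublinear h -> forall c x, 0 <= c -> h (c *: x) = c * h x.
Proof.
move=> [_ hZ] c x; rewrite le_eqVlt => /predU1P[<-|c0].
  (* Scaling 0 by 2 gives h 0 >= 0, and scaling it by 1/2 gives h 0 <= 0. *)
  have /= := hZ 2 0 ltac:(lra); have /= := hZ 2^-1 0 ltac:(lra).
  rewrite !scaler0 scale0r; lra.
apply/le_anti; rewrite hZ//=.
have ci : 0 < c^-1 by rewrite invr_gt0.
have := hZ _ (c *: x) ci; rewrite scalerA mulVf ?gt_eqF// scale1r.
by rewrite -(ler_pM2l c0) mulrA divff ?gt_eqF// mul1r.
Qed.

(* h' x = inf_{t >= 0} (h (x + t e) - t h e), so that h' (- e) <= - h e. *)
Lemma sublinear_straighten (R : realType) (V : lmodType R) (h : V -> R) e :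
  sublinear h -> exists h', [/\ sublinear h', forall x, h' x <= h x &
    h' e + h' (- e) <= 0].
Proof.
move=> sh; have [hD _] := sh.
pose S x := [set h (x + t *: e) - t * h e | t in [set t | 0 <= t]].
(* Subadditivity for t e = (x + t e) + (- x). Without a lower bound [inf] would be a default
   value. *)
have lbS x : lbound (S x) (- h (- x)).
  move=> _ [t /= t0 <-].
  have := hD (x + t *: e) (- x); rewrite addrAC subrr add0r (sublinearZ sh)//.
  lra.
have S0 x : S x !=set0 by exists (h (x + 0 *: e) - 0 * h e); exists 0 => /=.
have infS x t : 0 <= t -> inf (S x) <= h (x + t *: e) - t * h e.
  by move=> t0; apply: ge_inf; [exists (- h (- x)) | exists t].
have hh x : inf (S x) <= h x.
  by have := infS x 0 (lexx _); rewrite scale0r addr0; lra.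
exists (fun x => inf (S x)); split => //; last first.
  have := infS (- e) 1 ler01; rewrite scale1r addNr.
  have := hh e; have := sublinearZ sh 0 (lexx 0); rewrite scale0r; lra.
split=> [x y|c x c0].
  rewrite -lerBlDr; apply: lb_le_inf => // _ [t /= t0 <-].
  rewrite lerBlDr -lerBlDl; apply: lb_le_inf => // _ [s /= s0 <-].
  have := infS (x + y) (t + s) (addr_ge0 t0 s0).
  rewrite scalerDl addrACA; have := hD (x + t *: e) (y + s *: e); lra.
rewrite -ler_pdivrMl//; apply: lb_le_inf => // _ [t /= t0 <-].
rewrite ler_pdivrMl//.
have := infS (c *: x) (c * t) (mulr_ge0 (ltW c0) t0).
by rewrite -scalerA -scalerDr (sublinearZ sh _ (ltW c0)) mulrBr mulrA.
Qed.

(** Straightening in one direction only decreases the function, so h e + h (- e) <= 0 survives for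
    the directions treated before. *)
Lemma sublinear_straighten_seq (R : realType) (V : lmodType R) (h : V -> R)
    (s : seq V) :
  sublinear h -> exists h', [/\ sublinear h', forall x, h' x <= h x &
    forall e, e \in s -> h' e + h' (- e) <= 0].
Proof.
move=> sh; elim: s => [|e s [h1 [sh1 h1h h1s]]]; first by exists h.
have [h2 [sh2 h2h1 h2e]] := sublinear_straighten e sh1.
exists h2; split=> // [x|d]; first exact: le_trans (h1h x).
rewrite inE => /predU1P[->//|/h1s]; apply: le_trans.
exact: lerD.
Qed.

(** Finite-dimensional Hahn-Banach: straighten h to k along all [b j] and take the linear form with
    value [k (b j)] at coordinate j. With c_j the coordinates of x, k (- x) <= \sum_j k (- c_j b_j)
    <= - \sum_j c_j k (b_j), while - k (- x) <= k x. *)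
Lemma sublinear_minorant (R : realType) (X : finNormedModType R)
    (dot : {dot X for idfun}) (h : X -> R) :
  sublinear h -> exists u, forall x, dot u x <= h x.
Proof.
move=> sh; have [n [e [b xE]]] := dual_basis dot.
have [k [sk kh kb]] := sublinear_straighten_seq [seq b j | j <- enum 'I_n] sh.
have [kD _] := sk.
have k0 : k 0 = 0 by rewrite -(scale0r 0) (sublinearZ sk)// mul0r.
exists (\sum_j k (b j) *: e j) => x; apply: le_trans (kh x).
have kN y : - k (- y) <= k y by have := kD y (- y); rewrite subrr k0; lra.
apply: le_trans (kN x); rewrite lerNr [in leLHS](xE x) -sumrN.
rewrite linear_sumlz -sumrN.
apply: (@le_trans _ _ (\sum_j k (- (dot x (e j) *: b j)))).
  by elim/big_ind2: _ => [|y r y' r' yr yr'|//]; rewrite ?k0//;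
    apply: le_trans (kD _ _) _; apply: lerD.
apply: ler_sum => j _; rewrite linearZl_LR /= (dotC dot (e j)).
have /kb kbj : b j \in [seq b j | j <- enum 'I_n].
  by apply: map_f; rewrite mem_enum.
have [c0|c0] := leP 0 (dot x (e j)).
  rewrite -scalerN (sublinearZ sk)//; nra.
rewrite -scaleNr (sublinearZ sk); nra.
Qed.

(** * Convexity on a set and existence of subgradients *)

Lemma convex_setP (R : realType) (V : lmodType R) (O : set V) :
  convex_set O -> forall (t : R) x y, 0 <= t <= 1 -> O x -> O y ->
  O (t *: x + (1 - t) *: y).
Proof.
move=> hO t x y /andP[t0 t1] Ox Oy.
by have := hO x y (Itv01 t0 t1); rewrite !inE => /(_ Ox Oy).
Qed.

Lemma convex_functionP (R : realType) (V : lmodType R) (O : set V)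
    (f : V -> R) :
  convex_function O f <->
  forall (t : R) x y, 0 <= t <= 1 -> O x -> O y ->
    f (t *: x + (1 - t) *: y) <= t * f x + (1 - t) * f y.
Proof.
split=> [hf t x y /andP[t0 t1] Ox Oy|hf t x y].
  by have := hf (Itv01 t0 t1) x y; rewrite !inE => /(_ Ox Oy).
by rewrite !inE => Ox Oy; apply: hf => //; rewrite ge0 le1.
Qed.

Lemma open_absorbing (R : realType) (V : normedModType R) (O : set V) x :
  open O -> O x -> forall d, exists2 t : R, 0 < t & O (x + t *: d).
Proof.
move=> oO Ox d.
have : \forall t \near (0 : R), O (x + t *: d).
  have : (fun t : R => x + t *: d) @ (0 : R) --> x + (0 : R) *: d.
    by apply: cvgD; [exact: cvg_cst | apply: cvgZr_tmp; exact: cvg_id].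
  apply; rewrite scale0r addr0; exact: open_nbhs_nbhs.
move=> /nbhs_ballP[e /= e0 he]; exists (e / 2); first by rewrite divr_gt0.
apply: he; rewrite /ball /= sub0r normrN gtr0_norm ?divr_gt0//; lra.
Qed.

Lemma subgradient_exists (R : realType) (X : finNormedModType R)
    (dot : {dot X for idfun}) (O : set X) (m : X -> R) x :
  open O -> convex_set O -> convex_function O m -> O x ->
  subdifferential dot O m x !=set0.
Proof.
move=> oO cO cm Ox.
(* The directional derivative of m at x, as an infimum of difference
   quotients, is sublinear, and a linear minorant of it is a subgradient. *)
pose A d := [set t : R | 0 < t /\ O (x + t *: d)].
pose S d := [set (m (x + t *: d) - m x) / t | t in A d].
have S0 d : S d !=set0.
  have [t t0 Ot] := open_absorbing oO Ox d.
  by exists ((m (x + t *: d) - m x) / t), t.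
have quotD d1 d2 t1 t2 : A d1 t1 -> A d2 t2 -> exists2 t, A (d1 + d2) t &
    (m (x + t *: (d1 + d2)) - m x) / t <=
    (m (x + t1 *: d1) - m x) / t1 + (m (x + t2 *: d2) - m x) / t2.
  (* The weight s makes s t1 = (1 - s) t2 = t1 t2 / (t1 + t2), so the point reached along d1 + d2
     with this step is a convex combination of the two given points. *)
  move=> [t10 O1] [t20 O2]; pose s := t2 / (t1 + t2).
  have s01 : 0 <= s <= 1.
    by rewrite divr_ge0 ?ler_pdivrMr//=; lra.
  have t12 : t1 + t2 != 0 by rewrite gt_eqF// addr_gt0.
  have tE : x + (t1 * t2 / (t1 + t2)) *: (d1 + d2) =
      s *: (x + t1 *: d1) + (1 - s) *: (x + t2 *: d2).
    rewrite !scalerDr !scalerA addrACA -scalerDl subrKC scale1r /s.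
    by congr (_ + (_ *: _ + _ *: _)); field.
  exists (t1 * t2 / (t1 + t2)).
    split; first by rewrite divr_gt0 ?mulr_gt0 ?addr_gt0.
    by rewrite tE; exact: convex_setP.
  rewrite tE ler_pdivrMr ?divr_gt0 ?mulr_gt0 ?addr_gt0//.
  have := (convex_functionP O m).1 cm _ _ _ s01 O1 O2.
  set m1 := m (x + t1 *: d1); set m2 := m (x + t2 *: d2) => h.
  rewrite [leRHS](_ : _ = s * m1 + (1 - s) * m2 - m x); first lra.
  by rewrite /s; field; rewrite t12 !gt_eqF.
(* For opposite directions [quotD] has left side 0, so a quotient along - d bounds those along d
   from below. *)
have hlb d : has_lbound (S d).
  have [t t0 Ot] := open_absorbing oO Ox (- d).
  exists (- ((m (x + t *: - d) - m x) / t)) => _ [s As <-].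
  have [r _] := quotD _ _ _ _ As (conj t0 Ot).
  rewrite subrr scaler0 addr0 subrr mul0r; lra.
pose h d := inf (S d).
have hS d t : A d t -> h d <= (m (x + t *: d) - m x) / t.
  by move=> At; apply: ge_inf => //; exists t.
have sh : sublinear h.
  split=> [d1 d2|c d c0].
    rewrite -lerBlDr; apply: lb_le_inf => // _ [t1 /= A1 <-].
    rewrite lerBlDr -lerBlDl; apply: lb_le_inf => // _ [t2 /= A2 <-].
    have [t At] := quotD _ _ _ _ A1 A2.
    have := hS _ _ At; lra.
  rewrite -ler_pdivrMl//; apply: lb_le_inf => // _ [t [t0 Ot] <-].
  have Act : A (c *: d) (t / c).
    by split; [rewrite divr_gt0 | rewrite scalerA divfK ?gt_eqF].
  have := hS _ _ Act; rewrite scalerA divfK ?gt_eqF//.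
  rewrite ler_pdivrMl// => /le_trans; apply.
  by rewrite le_eqVlt; apply/predU1P; left; field; rewrite !gt_eqF.
have [u hu] := sublinear_minorant dot sh.
exists u => y Oy.
have A1 : A (y - x) 1 by split=> //; rewrite scale1r subrKC.
have := hS _ _ A1; have := hu (y - x).
rewrite divr1 scale1r subrKC; lra.
Qed.

(** * Compactness and relative subgradients on a bounded closed set *)

(** The set is the continuous image of a closed bounded set of coordinate vectors. *)
Lemma bounded_closed_compact_fin (R : realType) (X : finNormedModType R)
    (dot : {dot X for idfun}) (hdot : norm_of_dot dot) (C : set X) (M : R) :
  closed C -> (forall x, C x -> `|x| <= M) -> compact C.
Proof.
move=> cC CM; have [n [e [b xE]]] := dual_basis dot.
pose phi (w : 'rV[R]_n) := \sum_j w 0 j *: b j.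
have phi_cont : continuous phi.
  apply: continuous_big => [|j _ w]; first exact: add_continuous.
  apply: cvgZr_tmp; first exact: (nbhs_filter w).
  exact: coord_continuous.
(* A common bound for the coordinates: the squares of |x + e_j| and |x - e_j| are nonnegative, so
   |dot x e_j| <= (|x|^2 + |e_j|^2) / 2. *)
pose N := \sum_j (M ^+ 2 + `|e j| ^+ 2).
pose A := (phi @^-1` C) `&` [set w | `|w| <= N].
have cA : compact A.
  apply: bounded_closed_compact.
    exists N; split; first exact: num_real.
    by move=> r Nr w [_ /= wN]; exact: le_trans wN (ltW Nr).
  apply: closedI; first by apply: preimage_closed => // w _.
  have := @closed_closed_ball_ R 'rV[R]_n 0 N; congr closed.
  by apply/seteqP; split=> w; rewrite /closed_ball_ /= sub0r normrN.
rewrite (_ : C = phi @` A).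
  apply: continuous_compact cA.
  exact: continuous_subspaceT.
apply/seteqP; split => [x Cx|_ [w [Cw _] <-]//].
have phix : phi (\row_j dot x (e j)) = x.
  by rewrite [RHS]xE; apply: eq_bigr => j _; rewrite mxE.
exists (\row_j dot x (e j)) => //; split; rewrite /= ?phix//.
have N0 : 0 <= N by apply: sumr_ge0 => j _; rewrite addr_ge0 ?sqr_ge0.
rewrite [leLHS]/Num.norm /= mx_normrE; apply/bigmax_leP; split => //=.
move=> [i j] _ /=; rewrite mxE.
apply: (@le_trans _ _ (M ^+ 2 + `|e j| ^+ 2)); last first.
  rewrite /N (bigD1 j)//= lerDl; apply: sumr_ge0 => k _.
  by rewrite addr_ge0 ?sqr_ge0.
have xM : `|x| ^+ 2 <= M ^+ 2.
  by rewrite ler_sqr ?nnegrE ?CM// (le_trans _ (CM _ Cx)).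
have := sqr_ge0 `|x + e j|; rewrite (sqr_norm_add hdot).
have := sqr_ge0 `|x - e j|; rewrite (sqr_norm_add hdot) linearNr normrN.
move: (sqr_ge0 `|x|) (sqr_ge0 `|e j|); rewrite ler_norml; lra.
Qed.

(* At a minimizer x over C of the continuous function f - (M/2) |. - c|^2, with
   c at distance at least 1 from C, M (x - c) is a subgradient of f relative to
   C, for every M > 0. *)
Lemma bounded_relative_subgradients_trivial (R : realType)
    (X : finNormedModType R) (dot : {dot X for idfun})
    (hdot : norm_of_dot dot) (C : set X) (D kappa : R) (f : X -> R) :
  closed C -> C !=set0 -> (forall x y, C x -> C y -> `|x - y| <= D) ->
  {within C, continuous f} -> bounded_subgradients dot C C kappa f ->
  forall v : X, v = 0.
Proof.
move=> cC [x0 Cx0] CD fc fk v; apply/eqP/negPn/negP => v0.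
have D0 : 0 <= D by apply: le_trans (CD _ _ Cx0 Cx0).
pose c := x0 + ((D + 1) / `|v|) *: v.
have cx0 : `|c - x0| = D + 1.
  by rewrite /c addrAC subrr add0r normrZ normrM normfV normr_id divfK
    ?normr_eq0// ger0_norm ?addr_ge0.
have kC : compact C.
  apply: (bounded_closed_compact_fin (M := D + `|x0|) hdot) => // x Cx.
  by rewrite -(subrK x0 x) (le_trans (ler_normD _ _))// lerD2r CD.
have [M M0 kM] : exists2 M : R, 0 < M & kappa < M.
  exists (`|kappa| + 1); first by rewrite ltr_wpDl.
  by have := ler_norm kappa; lra.
have [] := @compact_EVT_min _ _ (fun y => f y - M / 2 * `|y - c| ^+ 2) C _ kC.
- by exists x0.
- have gc : continuous (fun y => M / 2 * `|y - c| ^+ 2).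
    move=> y; apply: cvgM; first exact: cvg_cst.
    apply: (@continuous_comp _ _ _ (fun y => `|y - c|) (fun r : R => r ^+ 2)).
      by apply: cvg_norm; apply: cvgB; [exact: cvg_id | exact: cvg_cst].
    exact: exprn_continuous.
  by apply: within_continuousB => //; exact: continuous_subspaceT.
move=> x /set_mem Cx xmin.
have : `|M *: (x - c)| <= kappa.
  (* Expanding |y - c|^2 around x turns minimality into the subgradient inequality with the surplus
     (M / 2) |y - x|^2. *)
  apply: fk Cx _ => y Cy; have := xmin y (mem_set Cy).
  rewrite (_ : y - c = (x - c) + (y - x)); last by rewrite [RHS]addrC subrKA.
  rewrite (sqr_norm_add hdot (x - c)) (linearZl_LR dot).
  have := mulr_ge0 (ltW M0) (sqr_ge0 `|y - x|); lra.
apply/negP; rewrite -ltNge.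
have xc : 1 <= `|x - c|.
  have := ler_normD (c - x) (x - x0); rewrite subrKA cx0 distrC.
  have := CD _ _ Cx Cx0; lra.
rewrite normrZ gtr0_norm//; apply: lt_le_trans kM _.
by rewrite ler_peMr// ltW.
Qed.

(** * Estimates for the model and for the proximal step *)

(** For open [O], a subgradient of m at x is one of h, since m <= h with equality at x; its norm is
    thus at most [kappa], and Young's inequality absorbs the linear term. For [O = C] the space is
    trivial and y = x. *)
Lemma model_lower_bound (R : realType) (X : finNormedModType R)
    (dot : {dot X for idfun}) (hdot : norm_of_dot dot) (C O : set X)
    (D kappa alpha : R) (h m : X -> R) (x y : X) :
  closed C -> admissible_domain C O ->
  (forall x y, C x -> C y -> `|x - y| <= D) ->
  {within O, continuous h} -> bounded_subgradients dot C O kappa h ->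
  is_model O h x m -> C x -> C y -> 0 < alpha ->
  h x - kappa ^+ 2 / (2 * alpha) <= m y + alpha / 2 * `|y - x| ^+ 2.
Proof.
move=> cC [CO cO OCo] CD hc hk [cm mh mx] Cx Cy a0.
have kk0 : 0 <= kappa ^+ 2 / (2 * alpha).
  by rewrite divr_ge0 ?sqr_ge0// mulr_ge0// ltW.
case: OCo => [OC|oO].
  rewrite OC in hc hk.
  have X0 :=
    bounded_relative_subgradients_trivial hdot cC (ex_intro _ x Cx) CD hc hk.
  by rewrite (X0 (y - x)) normr0 expr0n mulr0 addr0 (X0 y) -(X0 x) mx gerBl.
have [u mu] := subgradient_exists dot oO cO cm (CO _ Cx).
have uk : `|u| ^+ 2 <= kappa ^+ 2.
  have uk : `|u| <= kappa.
    by apply: hk Cx _ => z Oz; rewrite -mx; exact: le_trans (mu z Oz) (mh z Oz).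
  by rewrite ler_sqr ?nnegrE// (le_trans _ uk).
have := mu y (CO _ Cy); rewrite mx.
(* Young's inequality by completing the square; it is divided by 2 alpha below. *)
have := sqr_ge0 `|u + alpha *: (y - x)|.
rewrite (sqr_norm_add hdot u) (linearZr_LR dot) /= normrZ exprMn.
rewrite real_normK ?num_real//.
set d := dot u (y - x); set r := `|y - x| ^+ 2 => sq.
have : - (kappa ^+ 2 / (2 * alpha)) - alpha / 2 * r <= d.
  rewrite -subr_ge0.
  rewrite [leRHS](_ : _ =
    (kappa ^+ 2 + 2 * (alpha * d) + alpha ^+ 2 * r) / (2 * alpha)).
    by rewrite divr_ge0; lra.
  by field; rewrite gt_eqF.
lra.
Qed.

(** Compare z with t y + (1 - t) z: after division by t, convexity leaves an error proportional to
    t, which vanishes as t tends to 0. *)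
Lemma prox_three_point (R : realType) (X : finNormedModType R)
    (dot : {dot X for idfun}) (hdot : norm_of_dot dot) (C : set X)
    (phi : X -> R) (a : R) (c z y : X) :
  convex_set C -> convex_function C phi ->
  is_argmin C (fun w => phi w + a / 2 * `|w - c| ^+ 2) z -> C y ->
  phi z + a / 2 * `|z - c| ^+ 2 + a / 2 * `|y - z| ^+ 2 <=
  phi y + a / 2 * `|y - c| ^+ 2.
Proof.
move=> cC /convex_functionP cphi [Cz zmin] Cy.
have ycE : `|y - c| ^+ 2 =
    `|z - c| ^+ 2 + 2 * dot (z - c) (y - z) + `|y - z| ^+ 2.
  by rewrite -(sqr_norm_add hdot) [z - c + _]addrC subrKA.
have H t : 0 < t -> t <= 1 ->
    phi z <= phi y + a * dot (z - c) (y - z) + t * (a / 2 * `|y - z| ^+ 2).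
  move=> t0 t1; have t01 : 0 <= t <= 1 by rewrite ltW.
  have := zmin _ (convex_setP cC t01 Cy Cz).
  have := cphi _ _ _ t01 Cy Cz.
  rewrite (_ : t *: y + (1 - t) *: z - c = (z - c) + t *: (y - z)); last first.
    by rewrite scalerBl scalerBr scale1r addrCA addrAC.
  rewrite (sqr_norm_add hdot (z - c)) (linearZr_LR dot) /= normrZ exprMn.
  rewrite real_normK ?num_real//.
  set p := phi _; set d := dot _ _; set r := `|y - z| ^+ 2 => h1 h2.
  rewrite -(ler_pM2l t0); lra.
rewrite ycE; set r := `|y - z| ^+ 2 in H *; set d := dot _ _ in H *.
suff : phi z <= phi y + a * d by lra.
apply/ler_addgt0Pr => e e0.
have [ar0|ar0] := leP (a / 2 * r) 0.
  have := H 1 ltr01 (lexx _); lra.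
(* Chosen so that the error t (a / 2) |y - z|^2 is at most e. *)
pose t := Num.min 1 (e / (a / 2 * r)).
have t0 : 0 < t by rewrite lt_min ltr01 divr_gt0.
have := H t t0; rewrite ge_min lexx => /(_ isT).
have : t * (a / 2 * r) <= e by rewrite -ler_pdivlMr// ge_min lexx orbT.
lra.
Qed.

Lemma sqr_enorm (R : realType) (p : nat) (v : 'rV[R]_p) :
  enorm v ^+ 2 = \sum_(i < p) v 0 i ^+ 2.
Proof. by rewrite sqr_sqrtr// sumr_ge0// => i _; exact: sqr_ge0. Qed.

(** Componentwise, the positive part of a convex function is convex and nonnegative, and squaring is
    convex and increasing on nonnegative reals. *)
Lemma convex_aug_lagrangian (R : realType) (X : finNormedModType R) (p : nat)
    (C : set X) (sigma : R) (F : X -> R) (G : X -> 'rV[R]_p)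
    (lambda : 'rV[R]_p) :
  0 < sigma -> convex_function C F ->
  (forall i, convex_function C (fun y => G y 0 i)) ->
  convex_function C (fun z => aug_lagrangian sigma F G z lambda).
Proof.
move=> s0 /convex_functionP cF cG; apply/convex_functionP => t x y t01 Cx Cy.
rewrite /aug_lagrangian !sqr_enorm.
have [t0 t1] := andP t01.
set L := \sum_i lambda 0 i ^+ 2.
set Px := \sum_i pos_part (lambda + sigma *: G x) 0 i ^+ 2.
set Py := \sum_i pos_part (lambda + sigma *: G y) 0 i ^+ 2.
set P := \sum_i _.
have hP : P <= t * Px + (1 - t) * Py.
  rewrite !mulr_sumr -big_split /=; apply: ler_sum => i _; rewrite !mxE.
  have := (convex_functionP _ _).1 (cG i) _ _ _ t01 Cx Cy.
  set g := G _ 0 i; set gx := G x 0 i; set gy := G y 0 i => hg.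
  set a := Num.max (_ + _ * g) 0.
  set b := Num.max (_ + _ * gx) 0; set c := Num.max (_ + _ * gy) 0.
  have a0 : 0 <= a by rewrite le_max lexx orbT.
  have b0 : 0 <= b by rewrite le_max lexx orbT.
  have c0 : 0 <= c by rewrite le_max lexx orbT.
  have ac : a <= t * b + (1 - t) * c.
    rewrite ge_max addr_ge0 ?mulr_ge0 ?subr_ge0// andbT.
    have hb : lambda 0 i + sigma * gx <= b by rewrite le_max lexx.
    have hc : lambda 0 i + sigma * gy <= c by rewrite le_max lexx.
    have := ler_wpM2l t0 hb; have := ler_wpM2l (_ : 0 <= 1 - t) hc.
    rewrite subr_ge0 => /(_ t1); have := ler_wpM2l (ltW s0) hg; lra.
  apply: (@le_trans _ _ ((t * b + (1 - t) * c) ^+ 2)).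
    by rewrite ler_sqr ?nnegrE// (le_trans a0).
  rewrite -subr_ge0 [leRHS](_ : _ = t * (1 - t) * (b - c) ^+ 2); last ring.
  by rewrite mulr_ge0 ?sqr_ge0// mulr_ge0// subr_ge0.
have s20 : 0 <= (2 * sigma)^-1 by rewrite invr_ge0 mulr_ge0 ?ltW.
have := ler_wpM2l s20 hP; have := cF _ _ _ t01 Cx Cy; lra.
Qed.

(** * Telescoping with delay and the regret bound *)

(** The sum of the first n + k terms is split once at n and once at k, whichever of the two is
    larger. *)
Lemma delayed_telescope_sum (V : zmodType) (a : nat -> V) (n k : nat) :
  \sum_(i < n) (a i - a (i + k)%N) =
  \sum_(i < k) a i - \sum_(i < k) a (n + i)%N.
Proof.
rewrite sumrB; apply/eqP; rewrite subr_eq addrAC eq_sym subr_eq; apply/eqP.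
transitivity (\sum_(i < n + k) a i); last by rewrite big_split_ord.
rewrite addnC big_split_ord /=; congr (_ + _).
by apply: eq_bigr => i _; rewrite addnC.
Qed.

Lemma convex_functionS (R : realType) (V : lmodType R) (C O : set V)
    (f : V -> R) :
  C `<=` O -> convex_function O f -> convex_function C f.
Proof.
move=> CO /convex_functionP cf; apply/convex_functionP => t x y t01 Cx Cy.
by apply: cf => //; exact: CO.
Qed.

(** Makes the multiplier term of the augmented Lagrangian nonpositive at a feasible point: each new
    entry lies between 0 and the old one. *)
Lemma sqr_enorm_pos_part_le (R : realType) (p : nat) (lambda a : 'rV[R]_p)
    (sigma : R) :
  0 <= sigma -> (forall i, 0 <= lambda 0 i) -> (forall i, a 0 i <= 0) ->
  enorm (pos_part (lambda + sigma *: a)) ^+ 2 <= enorm lambda ^+ 2.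
Proof.
move=> s0 l0 a0; rewrite !sqr_enorm; apply: ler_sum => i _; rewrite !mxE.
rewrite ler_sqr ?nnegrE//; last by rewrite le_max lexx orbT.
by rewrite ge_max l0 andbT gerDl mulr_ge0_le0.
Qed.

Theorem theorem2 (R : realType) (X : finNormedModType R)
    (dot : {dot X for idfun}) (hdot : norm_of_dot dot)
    (C : set X) (hCclosed : closed C) (hCconvex : convex_set C)
    (O : set X) (hO : admissible_domain C O)
    (T p tau : nat) (hT : (1 <= T)%N) (hp : (1 <= p)%N) (htau : (tau < T)%N)
    (f : nat -> X -> R) (g : nat -> X -> 'rV[R]_p)
    (F : nat -> X -> X -> R) (G : nat -> X -> X -> 'rV[R]_p)
    (* Assumption 1 *)
    (D : R) (hD : 0 < D)
    (hbounded : forall x y, C x -> C y -> `|x - y| <= D)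
    (* Assumption 2 *)
    (kappa_f kappa_g : R) (hkappa_f : 0 < kappa_f) (hkappa_g : 0 < kappa_g)
    (hf : forall t, (t < T)%N ->
      [/\ {within O, continuous (f t)}, convex_function O (f t) &
          bounded_subgradients dot C O kappa_f (f t)])
    (hg : forall t (i : 'I_p), (t < T)%N ->
      [/\ {within O, continuous (fun y => g t y 0 i)},
          convex_function O (fun y => g t y 0 i) &
          bounded_subgradients dot C O kappa_g (fun y => g t y 0 i)])
    (* Assumption 3 *)
    (eps0 : R) (xhat : X) (heps0 : 0 < eps0) (hxhat : C xhat)
    (hslater : forall t (i : 'I_p), (t < T)%N -> g t xhat 0 i <= - eps0)
    (* Assumption 4 *)
    (hF : forall t x, (t < T)%N -> C x -> is_model O (f t) x (F t x))
    (hG : forall t x (i : 'I_p), (t < T)%N -> C x ->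
      is_model O (fun y => g t y 0 i) x (fun y => G t x y 0 i))
    (nu_g : R) (hnu_g : 0 < nu_g)
    (hGbounded : forall t x y, (t < T)%N -> C x -> C y ->
      enorm (G t x y) <= nu_g)
    (x : nat -> X) (lambda : nat -> 'rV[R]_p) (sigma alpha : R)
    (halpha : alpha = Num.sqrt (T%:R / (tau + 1)%:R))
    (hsigma : sigma = Num.sqrt ((tau + 1)%:R / T%:R))
    (halg : delayed_model_alm C T tau F G sigma alpha x lambda)
    (xstar : X)
    (hxstar : is_argmin (feasible_set C T g)
                (fun z => \sum_(t < T) f t z) xstar) :
  \sum_(t < T) (f t (x t) - f t xstar)
    <= (kappa_f ^+ 2 + nu_g ^+ 2 + D ^+ 2) / 2
       * Num.sqrt ((tau + 1)%:R * T%:R).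
Proof.
have [x0C init step] := halg.
have [CO _ _] := hO.
have T0 : 0 < T%:R :> R by rewrite ltr0n.
have t10 : 0 < (tau + 1)%:R :> R by rewrite ltr0n addn1.
have a0 : 0 < alpha by rewrite halpha sqrtr_gt0 divr_gt0.
have s0 : 0 < sigma by rewrite hsigma sqrtr_gt0 divr_gt0.
set q := Num.sqrt ((tau + 1)%:R * T%:R).
(* As alpha^2 = T / (tau + 1), the distance error alpha (tau + 1) and the subgradient error T /
   alpha both equal q. *)
have aq : alpha * (tau + 1)%:R = q.
  rewrite halpha /q -[X in _ * X](ger0_norm (ltW t10)) -sqrtr_sqr.
  rewrite -sqrtrM ?divr_ge0 ?ltW//; congr Num.sqrt.
  by field; rewrite gt_eqF.
have Tq : T%:R / alpha = q.
  apply: (mulIf (lt0r_neq0 a0)); rewrite divfK ?gt_eqF// -aq mulrAC -expr2.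
  rewrite halpha sqr_sqrtr ?divr_ge0 ?ltW//.
  by field; rewrite gt_eqF.
have [[Cxs gxs] _] := hxstar.
have xC t : (t <= tau + T)%N -> C (x t).
  have [/init[-> //]|taut tT] := leqP t tau.
  case: t taut tT => // t; rewrite ltnS => taut tT.
  by have [[]] := step t ltac:(by rewrite taut tT).
have l0 t i : (t <= tau + T)%N -> 0 <= lambda t 0 i.
  have [/init[_ ->]|taut tT] := leqP t tau; first by rewrite mxE.
  case: t taut tT => // t; rewrite ltnS => taut tT.
  have [_ ->] := step t ltac:(by rewrite taut tT).
  by rewrite mxE le_max lexx orbT.
pose d t := `|xstar - x t| ^+ 2.
pose L t := enorm (lambda t) ^+ 2.
have regret_step s : (s < T)%N -> f s (x s) - f s xstar <=
    kappa_f ^+ 2 / (2 * alpha) +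
    (2 * sigma)^-1 * (L (tau + s)%N - L (tau + s).+1) +
    alpha / 2 * (d s - d (s + (tau + 1))%N).
  move=> sT.
  have sC : C (x s) by apply: xC; rewrite (leq_trans (ltnW sT))// leq_addl.
  have [] := step (tau + s)%N; first by rewrite leq_addr ltn_add2l.
  rewrite addKn => xmin lE.
  have cF : convex_function C (F s (x s)).
    by have [cF _ _] := hF s (x s) sT sC; exact: convex_functionS cF.
  have cG i : convex_function C (fun y => G s (x s) y 0 i).
    by have [cG _ _] := hG s (x s) i sT sC; exact: convex_functionS cG.
  have cL := convex_aug_lagrangian (lambda (tau + s)%N) s0 cF cG.
  have := prox_three_point hdot hCconvex cL xmin Cxs.
  have x1C : C (x (tau + s).+1) by apply: xC; rewrite ltn_add2l.
  have [fc _ fk] := hf s sT.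
  have := model_lower_bound hdot hCclosed hO hbounded fc fk
    (hF s (x s) sT sC) sC x1C a0.
  have Fxs : F s (x s) xstar <= f s xstar.
    by have [_ Ff _] := hF s (x s) sT sC; exact: Ff (CO _ Cxs).
  have Gxs i : G s (x s) xstar 0 i <= 0.
    have [_ Gg _] := hG s (x s) i sT sC.
    exact: le_trans (Gg _ (CO _ Cxs)) (gxs s sT i).
  have ll i : 0 <= lambda (tau + s)%N 0 i by rewrite l0// leq_add2l ltnW.
  have := sqr_enorm_pos_part_le (ltW s0) ll Gxs.
  rewrite /aug_lagrangian -lE -!/(L _) /d.
  (* The iterate computed from the data of round s has index s + tau + 1, hence the shift by tau + 1
     in the distances. *)
  have -> : (s + (tau + 1))%N = (tau + s).+1 by rewrite addn1 addnS addnC.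
  set P := enorm _ ^+ 2 => PL.
  have s20 : 0 <= (2 * sigma)^-1 by rewrite invr_ge0 mulr_ge0// ltW.
  have := ler_wpM2l s20 PL; lra.
(* The sum telescopes to L tau - L (tau + T), and lambda_tau = 0. *)
have sumL : \sum_(s < T) (L (tau + s)%N - L (tau + s).+1) <= 0.
  rewrite (eq_bigr (fun s : 'I_T => - (L (tau + s.+1)%N - L (tau + s)%N))).
    rewrite sumrN -(big_mkord xpredT (fun s => L (tau + s.+1)%N - L (tau + s)%N)).
    rewrite telescope_sumr// addn0 oppr_le0 subr_ge0 {1}/L.
    have [_ ->] := init tau (leqnn _).
    by rewrite sqr_enorm big1 ?sqr_ge0// => i _; rewrite mxE expr0n.
  by move=> s _; rewrite opprB addnS.
(* The delayed telescoping leaves d_0, ..., d_tau, each at most D^2, minus nonnegative terms. *)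
have sumd : \sum_(s < T) (d s - d (s + (tau + 1))%N) <= (tau + 1)%:R * D ^+ 2.
  rewrite delayed_telescope_sum lerBlDr ler_wpDr ?sumr_ge0//.
    by move=> i _; exact: sqr_ge0.
  rewrite mulr_natl -[X in _ *+ X](card_ord (tau + 1)) -sumr_const.
  apply: ler_sum => i _.
  have xiC : C (x i).
    by apply: xC; rewrite (leq_trans (ltnW (ltn_ord i)))// leq_add2l.
  by rewrite ler_sqr ?nnegrE ?(ltW hD)// hbounded.
apply: (le_trans (ler_sum _ (fun (s : 'I_T) _ => regret_step s (ltn_ord s)))).
rewrite !big_split /= -!mulr_sumr sumr_const card_ord.
have -> : kappa_f ^+ 2 * ((2 * alpha)^-1 *+ T) = kappa_f ^+ 2 / 2 * q.
  by rewrite -[_ *+ T]mulr_natr -Tq; field; rewrite gt_eqF.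
have dq : alpha / 2 * \sum_(s < T) (d s - d (s + (tau + 1))%N) <= D ^+ 2 / 2 * q.
  rewrite (_ : D ^+ 2 / 2 * q = alpha / 2 * ((tau + 1)%:R * D ^+ 2)).
    by rewrite ler_wpM2l// divr_ge0 ?ltW.
  by rewrite -aq; ring.
have Lq : (2 * sigma)^-1 * \sum_(s < T) (L (tau + s)%N - L (tau + s).+1) <= 0.
  by rewrite mulr_ge0_le0// invr_ge0 mulr_ge0// ltW.
(* The estimates above add up to (kappa_f^2 + D^2) q / 2; adding this nonnegative term gives the
   stated constant. *)
have nuq : 0 <= nu_g ^+ 2 / 2 * q.
  by rewrite mulr_ge0 ?sqrtr_ge0 ?divr_ge0 ?sqr_ge0.
lra.
Qed.
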